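(* Let $G$ be a finite simple graph that has a minimum identifying code $I$ (that is, an identifying code with $|I| = \gamma^{\rm ID}(G)$) such that the induced subgraph $G[I]$ has no isolated vertices. Then $\gamma^{\rm ID}(G\Box K_2) \le 2\gamma^{\rm ID}(G)$.
   Context: All graphs are finite, simple and undirected. For a vertex $x$ of a graph $G$, $N[x]$ denotes the closed neighborhood ($x$ together with all its neighbors). A set $D\subseteq V(G)$ is a dominating set if $N[x]\cap D\neq\emptyset$ for every vertex $x$. An identifying code (ID code) of $G$ is a dominating set $C$ of $G$ such that $N[x]\cap C\neq N[y]\cap C$ for every two distinct vertices $x,y$ of $G$. $\gamma^{\rm ID}(G)$ denotes the minimum cardinality of an ID code of $G$. $G\Box H$ denotes the Cartesian product of graphs. *)

(* Defs.v *)
From HB Require Import structures.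
From mathcomp Require Import all_boot.

Set Implicit Arguments.
Unset Strict Implicit.
Unset Printing Implicit Defensive.

(* Finite simple undirected graphs. *)
Record sgraph := SGraph {
  vertex :> finType;
  adj : rel vertex;
  adj_sym : symmetric adj;
  adj_irrefl : irreflexive adj
}.

Section Codes.
Variable G : sgraph.
Implicit Types (x y : G) (C D : {set G}).

Definition cl_nbhd x : {set G} := [set y | (y == x) || adj x y].

Definition isolated x : bool := [forall y, ~~ adj x y].

Definition dominating D : bool := [forall x, cl_nbhd x :&: D != set0].

Definition id_code C : bool :=
  dominating C &&
  [forall x, forall y, (x != y) ==> (cl_nbhd x :&: C != cl_nbhd y :&: C)].

Definition identifiable : bool := [exists C, id_code C].

(* Only meaningful when G is identifiable; [arg min] otherwise returns its
   default [set: G]. *)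
Definition gammaID : nat := #|[arg min_(C < [set: G] | id_code C) #|C|]|.

(* The default is harmless: [set: G] is itself a code as soon as G has one. *)
Lemma id_code_setT C : id_code C -> id_code [set: G].
Proof.
case/andP=> /forallP domC /forallP sepC; apply/andP; split.
  by apply/forallP=> x; rewrite setIT; apply/set0Pn; exists x; rewrite inE eqxx.
apply/forallP=> x; apply/forallP=> y; apply/implyP=> xy; rewrite !setIT.
apply: contraTneq (implyP (forallP (sepC x) y) xy) => ->.
by rewrite eqxx.
Qed.

Lemma gammaIDP : identifiable ->
  (exists2 C, id_code C & #|C| = gammaID) /\
  (forall C, id_code C -> gammaID <= #|C|).
Proof.
case/existsP=> C /id_code_setT codeT; rewrite /gammaID.
by case: arg_minnP => // D codeD minD; split; first exists D.
Qed.

End Codes.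

Section Induced.
Variables (G : sgraph) (A : {set G}).

Definition induced_adj : rel {x : G | x \in A} :=
  fun u v => adj (val u) (val v).

Fact induced_adj_sym : symmetric induced_adj.
Proof. by move=> u v; rewrite /induced_adj adj_sym. Qed.

Fact induced_adj_irrefl : irreflexive induced_adj.
Proof. by move=> u; rewrite /induced_adj adj_irrefl. Qed.

Definition induced : sgraph := SGraph induced_adj_sym induced_adj_irrefl.

End Induced.

Section CartesianProduct.
Variables G H : sgraph.

Definition cart_adj : rel (G * H)%type := fun p q =>
  ((p.1 == q.1) && adj p.2 q.2) || ((p.2 == q.2) && adj p.1 q.1).

Fact cart_adj_sym : symmetric cart_adj.
Proof.
move=> p q; rewrite /cart_adj (eq_sym p.1) (eq_sym p.2).
by rewrite (adj_sym p.1) (adj_sym p.2).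
Qed.

Fact cart_adj_irrefl : irreflexive cart_adj.
Proof. by move=> p; rewrite /cart_adj !adj_irrefl !andbF. Qed.

Definition cart_prod : sgraph := SGraph cart_adj_sym cart_adj_irrefl.

End CartesianProduct.

Section Complete.
Variable n : nat.

Definition complete_adj : rel 'I_n := fun i j => i != j.

Fact complete_adj_sym : symmetric complete_adj.
Proof. by move=> i j; rewrite /complete_adj eq_sym. Qed.

Fact complete_adj_irrefl : irreflexive complete_adj.
Proof. by move=> i; rewrite /complete_adj eqxx. Qed.

Definition complete : sgraph := SGraph complete_adj_sym complete_adj_irrefl.

End Complete.

(* Main.v *)
Require Import Defs.
From HB Require Import structures.
From mathcomp Require Import all_boot.

(** If [I] is an identifying code of [G] without isolated vertices in [G[I]],
    then [I * V(H)] is an identifying code of [G □ H], for every graph [H].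
    Two vertices of the same layer are separated inside that layer by [I].  If
    [(x, i)] and [(y, j)] with [i != j] were not separated, then comparing
    layer [i] gives [N[x] :&: I \subset [set y]] and comparing layer [j] gives
    [N[y] :&: I \subset [set x]]; domination puts [y] in [I], hence [x = y], and
    [y] is isolated in [G[I]]. *)

Lemma cl_nbhd_cart_layer (G H : sgraph) (x z : G) (i : H) :
  (((z, i) : cart_prod G H) \in cl_nbhd ((x, i) : cart_prod G H))
    = (z \in cl_nbhd x).
Proof.
by rewrite !inE /= /cart_adj /= xpair_eqE !eqxx adj_irrefl !andbF andbT.
Qed.

Lemma cl_nbhd_cart_cross (G H : sgraph) (x z : G) (i k : H) :
  k != i -> ((z, k) : cart_prod G H) \in cl_nbhd ((x, i) : cart_prod G H) ->
  z = x.
Proof.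
move=> ki; rewrite !inE /= /cart_adj /= xpair_eqE (eq_sym i) (negPf ki) !andbF.
by rewrite orbF => /andP[/eqP].
Qed.

Lemma id_code_setX_setT (G H : sgraph) (I : {set G}) :
  id_code I -> (forall x : induced I, ~~ isolated x) ->
  @id_code (cart_prod G H) (setX I [set: H]).
Proof.
case/andP=> /forallP domI /forallP sepI noiso; apply/andP; split.
  apply/forallP=> -[x i]; have /set0Pn[z /setIP[xz zI]] := domI x.
  apply/set0Pn; exists (z, i).
  by rewrite inE cl_nbhd_cart_layer xz in_setX zI inE.
apply/forallP=> -[x i]; apply/forallP=> -[y j]; apply/implyP=> neq.
apply/eqP=> /setP eqN.
have mem_eq z k : z \in I ->
    (((z, k) : cart_prod G H) \in cl_nbhd ((x, i) : cart_prod G H)) =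
    (((z, k) : cart_prod G H) \in cl_nbhd ((y, j) : cart_prod G H)).
  by move=> zI; have := eqN (z, k); rewrite !(in_setI, in_setX) zI in_setT !andbT.
case: (eqVneq i j) => [eij | nij].
  subst j; have nxy : x != y by apply: contraNneq neq => ->.
  have /eqP[] := implyP (forallP (sepI x) y) nxy.
  apply/setP=> z; rewrite !in_setI; case: (boolP (z \in I)) => zI; last first.
    by rewrite !andbF.
  by have := mem_eq z i zI; rewrite !cl_nbhd_cart_layer => ->.
(* As [z] is in [I], [mem_eq] carries [(z, i)] into the closed neighborhood of [(y, j)], whose only
   vertex in layer [i] is [(y, i)]. *)
have onlyy z : z \in I -> z \in cl_nbhd x -> z = y.
  move=> zI; rewrite -(cl_nbhd_cart_layer G H x z i) mem_eq //.
  exact: cl_nbhd_cart_cross.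
have onlyx z : z \in I -> z \in cl_nbhd y -> z = x.
  move=> zI; rewrite -(cl_nbhd_cart_layer G H y z j) -mem_eq //.
  by apply: cl_nbhd_cart_cross; rewrite eq_sym.
have /set0Pn[z /setIP[xz zI]] := domI x.
have yI : y \in I by rewrite -(onlyy z zI xz).
have eyx : y = x by apply: onlyx; rewrite // inE eqxx.
(* A neighbor [w] of [y] inside [I] is equal to [x] by [onlyx], hence to [y]: a loop. *)
have /forallPn[[w wI] /negPn yw] := noiso (Sub y yI).
have ewx : w = x by apply: onlyx; rewrite // inE [adj _ _]yw orbT.
by move: yw; rewrite /= /induced_adj /= ewx eyx adj_irrefl.
Qed.

Theorem theorem8 (G : sgraph)
  (hI : exists I : {set G},
     [/\ id_code I, #|I| = gammaID G
       & forall x : induced I, ~~ isolated x]) :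
  identifiable (cart_prod G (complete 2)) /\
  gammaID (cart_prod G (complete 2)) <= 2 * gammaID G.
Proof.
case: hI => I [codeI cardI noiso].
have codeX := id_code_setX_setT G (complete 2) I codeI noiso.
(* With a code at hand, [gammaID] is a true minimum and not the size of its default set. *)
have idX : identifiable (cart_prod G (complete 2)).
  by apply/existsP; exists (setX I [set: complete 2]).
split=> //; have [_ /(_ _ codeX)] := gammaIDP idX.
by rewrite cardsX cardsT card_ord cardI mulnC.
Qed.
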